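(* Let $\mathcal{S}=\{S_1,\dots,S_m\}$ be an FI($s$)-system of contracting similarities in $\mathbb{R}^d$ satisfying the open set condition, with attractor $K$. Then: 1) for any $x\in K$ there is a family $J\prec\pi^{-1}(x)$ such that for any non-equal $\mathbf{j},\mathbf{k}\in J$, $K_{\mathbf j}\cap K_{\mathbf k}=\{x\}$, and the number of connected components of $V_J(x)\setminus\{x\}$ is equal to $N_C(x)$; 2) for any $\mathbf{i}\in I^*$ there is a family $J\prec\pi^{-1}(\partial K_{\mathbf i})$ such that for any $\mathbf{j}\in J$ the set $K_{\mathbf j}\cap\partial K_{\mathbf i}$ is a single point, the sets $K_{\mathbf j}\setminus K_{\mathbf i}$, $\mathbf j\in J$, are pairwise disjoint, and the number of connected components of $V_J(K_{\mathbf i})\setminus K_{\mathbf i}$ is equal to $N_C(K_{\mathbf i})$.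
   Context: The attractor of $\mathcal{S}$ is the unique nonempty compact $K$ with $K=\bigcup_{i=1}^m S_i(K)$. Let $I=\{1,\dots,m\}$, $I^*=\bigcup_{n\ge1}I^n$, and for $\mathbf{j}=j_1\dots j_n\in I^*$ let $S_{\mathbf j}=S_{j_1}\cdots S_{j_n}$ and $K_{\mathbf j}=S_{\mathbf j}(K)$. FI($s$)-system: the attractor $K$ is connected (a continuum), and $\#(K_i\cap K_j)\le s$ for all $i\ne j$ in $I$, where $s$ is a fixed natural number. Open set condition: there is a nonempty open set $O\subset\mathbb{R}^d$ such that the sets $S_i(O)$, $1\le i\le m$, are pairwise disjoint and contained in $O$. Index map: $\pi:I^\infty\to K$ sends $\alpha=\alpha_1\alpha_2\dots$ to the unique point of $\bigcap_{n\ge1} K_{\alpha_1\dots\alpha_n}$. Boundary of a piece: for $\mathbf{i}\in I^n$, $\partial K_{\mathbf i}=\bigcup_{\mathbf{j}\in I^n\setminus\{\mathbf i\}}(K_{\mathbf j}\cap K_{\mathbf i})$. Relation $\prec$: two words in $I^*$ are incomparable if neither is an initial segment of the other. For $A\subset I^\infty$, $J\prec A$ means that $J\subset I^*$ is a set of pairwise incomparable words and there is a surjection $\psi:A\to J$ such that $\psi(\alpha)$ is an initial segment of $\alpha$ for every $\alpha\in A$. For $J\prec\pi^{-1}(x)$ put $V_J(x)=\bigcup_{\mathbf j\in J}K_{\mathbf j}$; for $J\prec\pi^{-1}(\partial K_{\mathbf i})$ put $V_J(K_{\mathbf i})=K_{\mathbf i}\cup\bigcup_{\mathbf j\in J}K_{\mathbf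 j}$. $N_C(A)$, for $A=\{x\}$ (written $N_C(x)$) or $A=K_{\mathbf i}$, is the supremum, over all compact connected neighborhoods $V$ of $A$ in $K$, of the number of connected components of $V\setminus A$. *)

(* Defs.v *)
From HB Require Import structures.
From mathcomp Require Import all_boot all_order all_algebra.
From mathcomp Require Import all_classical all_reals all_analysis.

Set Implicit Arguments.
Unset Strict Implicit.
Unset Printing Implicit Defensive.
Import Order.TTheory GRing.Theory Num.Theory.
Import numFieldNormedType.Exports.
Local Open Scope classical_set_scope.
Local Open Scope ring_scope.

(** The alphabet {1, ..., m} is ['I_m], finite words are [seq 'I_m] and
    infinite words are [nat -> 'I_m]; R^d is ['rV[R]_d].  The library norm on
    ['rV[R]_d] is the sup norm (it induces the usual topology), whereas
    similarities refer to the Euclidean metric. *)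
Definition euclid_dist (R : realType) (d : nat) (x y : 'rV[R]_d) : R :=
  Num.sqrt (\sum_(k < d) (x 0 k - y 0 k) ^+ 2).

Definition contracting_similarity (R : realType) (d : nat)
    (f : 'rV[R]_d -> 'rV[R]_d) : Prop :=
  exists r : R, [/\ 0 < r, r < 1 &
    forall x y, euclid_dist (f x) (f y) = r * euclid_dist x y].

Section IteratedFunctionSystem.
Context (R : realType) (d m : nat).
Local Notation E := 'rV[R]_d.
Local Notation word := (seq 'I_m).
Local Notation infword := (nat -> 'I_m).
Implicit Types (S : 'I_m -> E -> E) (K A : set E) (w u v i j : word)
  (alpha : infword) (J : set word).

Definition is_attractor S K : Prop :=
  [/\ K !=set0, compact K & K = \bigcup_(a in [set: 'I_m]) S a @` K].

Definition FI_system (s : nat) S K : Prop :=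
  [/\ is_attractor S K, connected K &
    forall a b : 'I_m, a != b -> ((S a @` K) `&` (S b @` K) #<= `I_s)%card].

Definition open_set_condition S : Prop :=
  exists O : set E, [/\ O !=set0, open O,
    trivIset [set: 'I_m] (fun a => S a @` O) & forall a, S a @` O `<=` O].

(** [nonempty_words] is I^*, which excludes the empty word. *)
Definition nonempty_words : set word := [set w | w != [::]].

Definition word_map S w : E -> E := foldr (fun a f => S a \o f) id w.

Definition piece S K w : set E := word_map S w @` K.

Definition initial_segment w alpha : Prop := w = mkseq alpha (size w).

Definition incomparable u v : bool := ~~ prefix u v && ~~ prefix v u.

(** The unique point of the intersection; the default value 0 is never taken
    when [K] is the attractor of a system of contractions. *)
Definition ifs_index_map S K alpha : E :=
  xget 0 (\bigcap_n piece S K (mkseq alpha n.+1)).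

Definition piece_boundary S K i : set E :=
  \bigcup_(j in [set j | size j = size i /\ j != i])
    (piece S K j `&` piece S K i).

(** [prec J A] is J ≺ A; only the values of [psi] on [A] matter. *)
Definition prec J (A : set infword) : Prop :=
  [/\ J `<=` nonempty_words,
      forall u v, J u -> J v -> u <> v -> incomparable u v &
      exists psi : infword -> word, psi @` A = J /\
        forall alpha, A alpha -> initial_segment (psi alpha) alpha].

(** V_J(x) and V_J(K_i). *)
Definition V_point S K J : set E := \bigcup_(j in J) piece S K j.

Definition V_piece S K J i : set E :=
  piece S K i `|` \bigcup_(j in J) piece S K j.

(** Number of connected components, with value +oo if there are infinitely
    many of them. *)
Definition num_components A : \bar R := counting (connected_component A @` A).

(** [V] is a compact connected neighbourhood of [A] in the subspace [K]. *)
Definition continuum_nbhd K A (V : set E) : Prop :=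
  [/\ V `<=` K, compact V, connected V & within K (set_nbhs A) V].

Definition N_C K A : \bar R :=
  ereal_sup [set num_components (V `\` A) | V in continuum_nbhd K A].

End IteratedFunctionSystem.

(* Main.v *)
Require Import Defs.
From HB Require Import structures.
From mathcomp Require Import all_boot all_order all_algebra.
From mathcomp Require Import finmap.
From mathcomp Require Import all_classical all_reals all_analysis.
From mathcomp Require Import ring lra zify.
Set Implicit Arguments.
Unset Strict Implicit.
Unset Printing Implicit Defensive.
Import Order.TTheory GRing.Theory Num.Theory.
Import numFieldNormedType.Exports.
Local Open Scope classical_set_scope.
Local Open Scope ring_scope.

(** Let [A] be [{x}] or [K_i], and let [V_n] be the union of the pieces of level [n]
    that meet [A]; these are continuum neighbourhoods shrinking to [A].  By boundary
    bumping every component of [V \ A] accumulates at [A], so the number of components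
    grows as [V] shrinks and [N_C(A)] is the limit of the counts for [V_n].  If
    [K \ A] has infinitely many components, all counts are infinite.  Otherwise, for
    [n] large, no component of [K \ A] lies in [V_n]; since [V_n] is locally connected,
    every component of [V_n \ A] must then meet a piece of level [n] outside [V_n].
    The open set condition bounds both the number of addresses of a point and,
    uniformly in [w], the number of points of the boundary of [K_w], so the counts are
    bounded integers and become stationary: the limit is attained by [V_n], which is
    [V_J] for the family [J] of words of length [n] meeting [x] or the boundary of [K_i]. *)

(** If no member lay in [O], the sets [D \ O] would generate a proper filter; a cluster point of it
    belongs to every closed [D \ O], hence to the intersection but not to [O]. *)
Lemma compact_directed_sub (T : topologicalType) (F : set (set T)) (O : set T) :
    F !=set0 -> (forall D, F D -> compact D /\ closed D) ->
    (forall D1 D2, F D1 -> F D2 -> F (D1 `&` D2)) -> open O ->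
    \bigcap_(D in F) D `<=` O ->
  exists2 D, F D & D `<=` O.
Proof.
move=> [D0 FD0] Fcl FI oO FO; apply: contrapT => noD.
have DO D : F D -> D `\` O !=set0.
  move=> FD; apply/set0P/eqP => DO0; apply: noD; exists D => //.
  by rewrite -setD_eq0.
have Gf : ProperFilter (filter_from F (fun D => D `\` O)).
  apply: filter_from_proper => //; apply: filter_from_filter; first by exists D0.
  move=> D1 D2 FD1 FD2; exists (D1 `&` D2); first exact: FI.
  by move=> x [[D1x D2x] Ox].
have [|q [_ qF]] := (Fcl _ FD0).1 (filter_from F (fun D => D `\` O)) Gf.
  by exists D0 => // x [].
have Dq D : F D -> (D `\` O) q.
  move=> FD; have clD : closed (D `\` O).
    by rewrite setDE; apply: closedI; [exact: (Fcl _ FD).2 | exact: open_closedC].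
  move/closure_id: clD => -> U Uq.
  by apply: qF => //; exists D.
have /FO : (\bigcap_(D in F) D) q by move=> D /Dq[].
by have [] := Dq _ FD0.
Qed.

(** * Connected components of compact sets *)

Section Components.
Context {R : realType} {T : pseudoMetricType R}.
Hypothesis hausdorffT : hausdorff_space T.
Implicit Types (A C D K O V W : set T) (p x y : T).

Lemma closed_disjoint_separated A C :
  closed A -> closed C -> A `&` C = set0 -> separated A C.
Proof.
by move=> /closure_id clA /closure_id clC AC0; split; rewrite -?clA -?clC.
Qed.

Lemma connected_clopen_sub W D C x : closed D -> closed (W `\` D) ->
  connected C -> C `<=` W -> C x -> D x -> C `<=` D.
Proof.
move=> clD clWD conC CW Cx Dx.
have /connected_subset sCD : separated D (W `\` D).
  by apply: closed_disjoint_separated => //; rewrite setDE setICA setICr setI0.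
have [||//|CWD] := sCD C => //.
  by move=> y /CW Wy; have [Dy|nDy] := pselect (D y); [left|right].
by have [] := CWD _ Cx.
Qed.

(* The intersection of all clopen neighbourhoods of [p] in [W] is connected, hence
   contained in the component of [p]; by compactness a single one lies in [O]. *)
Lemma component_sub_clopen W O p : compact W -> W p -> open O ->
    connected_component W p `<=` O ->
  exists D, [/\ closed D, closed (W `\` D), D `<=` W, D p & D `<=` O].
Proof.
move=> cW Wp oO compO; have clW : closed W by exact: compact_closed.
pose F := [set D | [/\ closed D, closed (W `\` D), D `<=` W & D p]].
have FW : F W by split => //; rewrite setDv; exact: closed0.
have FI D1 D2 : F D1 -> F D2 -> F (D1 `&` D2).
  move=> [cl1 clW1 D1W D1p] [cl2 clW2 D2W D2p]; split => //.
  - exact: closedI.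
  - by rewrite setDIr; apply: closedU.
  - by move=> x [/D1W].
have Fcl D : F D -> compact D /\ closed D.
  by move=> [clD _ DW _]; split => //; exact: subclosed_compact DW.
pose Q := \bigcap_(D in F) D.
have clQ : closed Q by apply: closed_bigI => D /Fcl[].
have Qp : Q p by move=> D [].
have QW : Q `<=` W by move=> x /(_ _ FW).
suff conQ : connected Q.
  have [//|D [clD clWD DW Dp] DO] := compact_directed_sub (O := O) (ex_intro _ _ FW) Fcl FI oO _.
    apply: subset_trans compO; exact: connected_component_max.
  by exists D.
apply/connectedP => E [E0 EQ sE].
wlog Ep : E E0 EQ sE / E false p.
  move=> G; have : Q p by [].
  rewrite EQ => -[Efp|Etp]; first exact: (G E).
  apply: (G (E \o negb)) => //; first by case => /=.
    by rewrite EQ setUC.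
  by rewrite separatedC.
have clE b : closed (E b).
  rewrite closure_id eqEsubset; split; first exact: subset_closure.
  move=> x Ex; have Qx : Q x.
    move/closure_id: clQ => ->; apply: closureS Ex; rewrite EQ.
    by case: b => y; [right|left].
  move: Qx; rewrite EQ; case: sE => s1 s2.
  case: b Ex => Ex [] // Ey; exfalso.
  + by have : (E false `&` closure (E true)) x by []; rewrite s2.
  + by have : (closure (E false) `&` E true) x by []; rewrite s1.
have [U [V [oU oV EU EV UV0]]] := (@normal_openP R T).1
  (@pseudometric_normal R T) _ _ (clE false) (clE true) (separated_disjoint sE).
(* A clopen [D] inside [U] and [V] together is cut by them into clopen parts. So [D] intersected
   with [U] is again in [F] and contains [Q], although [Q] has a point in [V]. *)
have [D FD DUV] : exists2 D, F D & D `<=` U `|` V.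
  apply: (compact_directed_sub (ex_intro _ _ FW) Fcl FI); first exact: openU.
  by rewrite -/Q EQ => x [/EU|/EV]; [left|right].
have FDU : F (D `&` U).
  have [clD clWD DW Dp] := FD.
  have DUE : D `&` U = D `\` V.
    apply/seteqP; split => x [Dx].
      by move=> Ux; split => // Vx; have : (U `&` V) x by []; rewrite UV0.
    by move=> nVx; split => //; case: (DUV _ Dx).
  split.
  - by rewrite DUE setDE; apply: closedI => //; exact: open_closedC.
  - have -> : W `\` (D `&` U) = (W `\` D) `|` (D `\` U).
      apply/seteqP; split => x.
        move=> [Wx nDUx]; have [Dx|nDx] := pselect (D x); last by left.
        by right; split => // Ux; apply: nDUx.
      by move=> [[Wx nDx]|[Dx nUx]]; split; [| case | exact: DW | case].
    by apply: closedU => //; rewrite setDE; apply: closedI => //; exact: open_closedC.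
  - by move=> x [/DW].
  - by split => //; exact: EU.
have [z Etz] := E0 true.
have [_ Uz] : (D `&` U) z.
  suff : Q z by apply.
  by rewrite EQ; right.
by have : (U `&` V) z; [split => //; exact: EV | rewrite UV0].
Qed.

(* Boundary bumping. *)
Lemma component_meets_nbhs V A O p : compact V -> connected V -> closed A ->
    V `&` A !=set0 -> open O -> A `<=` O -> V p -> ~ A p ->
  connected_component (V `\` A) p `&` O !=set0.
Proof.
move=> cV conV clA [a [Va Aa]] oO AO Vp nAp; apply/set0P/eqP => CO0.
have clV : closed V by exact: compact_closed.
have clO : closed (~` O) by exact: open_closedC.
have AO0 : A `&` ~` O = set0 by apply/disjoints_subset; rewrite setCK.
have [U1 [U2 [oU1 oU2 AU1 OU2 U12]]] := (@normal_openP R T).1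
  (@pseudometric_normal R T) _ _ clA clO AO0.
pose W := V `\` U1.
have cW : compact W.
  apply: subclosed_compact cV _; last by move=> x [].
  by rewrite /W setDE; apply: closedI => //; exact: open_closedC.
have CnO x : connected_component (V `\` A) p x -> ~ O x.
  by move=> Cx Ox; have : (connected_component (V `\` A) p `&` O) x by []; rewrite CO0.
have Cp : connected_component (V `\` A) p p by exact: connected_component_refl.
have U2nU1 x : U2 x -> ~ U1 x.
  by move=> U2x U1x; have : (U1 `&` U2) x by []; rewrite U12.
have Wp : W p by split => //; apply/U2nU1/OU2/CnO.
have WVA : W `<=` V `\` A by move=> x [Vx nU1x]; split => // /AU1.
(* The component of [p] in [W] lies in its component in [V \ A], which is assumed to miss [O] and
   thus lies in [U2]. *)
have [|D [clD clWD DW Dp DU2]] := component_sub_clopen cW Wp oU2.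
  move=> x [B [Bp BW conB] Bx]; apply/OU2/CnO.
  by exists B => //; split => //; apply: subset_trans BW WVA.
(* Since [D] stays inside [U2], away from [U1], it is clopen in all of [V] and not only in [W].
   Connectedness then puts [V], including its point of [A], inside [D]. *)
have clVD : closed (V `\` D).
  have -> : V `\` D = (W `\` D) `|` (V `\` U2).
    apply/seteqP; split => x.
      move=> [Vx nDx]; have [U2x|nU2x] := pselect (U2 x); last by right.
      by left; split => //; split => //; exact: U2nU1.
    by move=> [[[Vx _] nDx]|[Vx nU2x]]; split => // /DU2.
  by apply: closedU => //; rewrite setDE; apply: closedI => //; exact: open_closedC.
have VD := connected_clopen_sub clD clVD conV (@subset_refl _ V) Vp Dp.
by have [_] := DW _ (VD _ Va); apply; exact: AU1.
Qed.

End Components.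

Lemma counting_le_surj (R : realType) (T U : choiceType) (X : set T) (Y : set U)
    (g : U -> T) :
  X `<=` g @` Y -> (counting X <= counting Y :> \bar R)%E.
Proof.
move=> XY; rewrite /counting; have [fY|infY] := pselect (finite_set Y); last first.
  by rewrite (asboolF infY) leey.
have fgY : finite_set (g @` Y) by exact: finite_image.
have fX : finite_set X by exact: sub_finite_set XY fgY.
rewrite !asboolT // lee_fin ler_nat.
apply: (@leq_trans #|` fset_set (g @` Y)|).
  by apply: fsubset_leq_card; rewrite -fset_set_sub.
by rewrite fset_set_image //; exact: leq_imfset_card.
Qed.

(** The bound is witnessed by an enclosing list, possibly with repetitions, so that images and
    unions reduce to [map] and [flatten]. *)
Definition card_at_most (T : eqType) (n : nat) (A : set T) : Prop :=
  exists2 s : seq T, (size s <= n)%N & A `<=` [set` s].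

(** * Counting the components of [V \ A] *)

Section Euclid.
Context {R : realType} {d : nat}.
Local Notation E := 'rV[R]_d.
Implicit Types (A K V W : set E) (p x y : E).

Let hausdorffE : hausdorff_space E := @norm_hausdorff R E.

(** Each component of [V \ A] lies in one component of [V' \ A], and by hypothesis every component
    of the latter arises in this way. Taking the union in [g] avoids choosing a base point. *)
Lemma num_components_le A V V' : V `<=` V' ->
    (forall p, V' p -> ~ A p -> connected_component (V' `\` A) p `&` V !=set0) ->
  (num_components (V' `\` A) <= num_components (V `\` A))%E.
Proof.
move=> VV' meet; pose g (C : set E) := \bigcup_(x in C) connected_component (V' `\` A) x.
apply: (@counting_le_surj _ _ _ _ _ g) => _ [p [V'p nAp] <-].
have [q [pq Vq]] := meet _ V'p nAp.
have [V'q nAq] := connected_component_sub pq.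
exists (connected_component (V `\` A) q); first by exists q.
rewrite (same_connected_component pq); apply/seteqP; split => x.
  move=> [y [B [Bq BV conB] By]]; apply: connected_component_trans; exists B => //.
  by split => //; apply: subset_trans BV _ => z [/VV'].
by move=> qx; exists q => //; exact: connected_component_refl.
Qed.

(** By boundary bumping every component of [V' \ A] enters any open set around [A]; one such open
    set has its trace on [K] inside [V]. *)
Lemma num_components_antitone K A V V' : closed A -> A !=set0 -> A `<=` K ->
    continuum_nbhd K A V -> continuum_nbhd K A V' -> V `<=` V' ->
  (num_components (V' `\` A) <= num_components (V `\` A))%E.
Proof.
move=> clA [a Aa] AK [_ _ _ /set_nbhsP[G [oO AO OV]]] [V'K cV' conV' nV'] VV'.
apply: num_components_le => // p V'p nAp.
have [|q [Cq Oq]] := component_meets_nbhs hausdorffE cV' conV' clA _ oO AO V'p nAp.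
  by exists a; split => //; exact: (nbhs_singleton (nV' _ Aa) (AK _ Aa)).
exists q; split => //; apply: OV => //.
by have [/V'K] := connected_component_sub Cq.
Qed.

(* For compact sets this is local connectedness. *)
Definition finely_connected V := forall e : R, 0 < e ->
  exists F : set (set E), [/\ finite_set F,
    forall P, F P -> [/\ closed P, connected P & forall x y, P x -> P y -> ball x e y]
    & V = \bigcup_(P in F) P].

Lemma component_near V A p : finely_connected V -> closed A -> V p -> ~ A p ->
  \forall y \near p, V y -> connected_component (V `\` A) p y.
Proof.
move=> fV clA Vp nAp.
have /nbhs_ballP[e /= e0 pe] : nbhs p (~` A).
  by apply: open_nbhs_nbhs; split => //; exact: closed_openC.
have [F [finF FP VF]] := fV _ e0.
pose G := \bigcup_(P in [set P | F P /\ ~ P p]) P.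
have clG : closed G.
  apply: closed_bigcup; first by apply: sub_finite_set finF => P [].
  by move=> P [/FP[]].
have : nbhs p (~` G).
  apply: open_nbhs_nbhs; split; first exact: closed_openC.
  by move=> [P []].
apply: filterS => y nGy; rewrite {1}VF => -[P FP' Py].
have Pp : P p by apply: contrapT => nPp; apply: nGy; exists P.
have [_ conP dP] := FP _ FP'.
exists P => //; split => // z Pz; split; first by rewrite VF; exists P.
exact/pe/dP.
Qed.

(** A component of [V \ A] that misses [W] is clopen in the component of [K \ A] around it, because
    [K] coincides with [V] off [W]; hence it is that whole component. *)
Lemma component_trapped K V W A p : finely_connected V -> closed V ->
    closed W -> closed A -> V `<=` K -> K `<=` V `|` W -> V p -> ~ A p ->
    connected_component (V `\` A) p `&` W = set0 ->
  connected_component (K `\` A) p `<=` V.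
Proof.
move=> fV clV clW clA VK KVW Vp nAp CW0.
pose C := connected_component (V `\` A) p; pose D := connected_component (K `\` A) p.
have CV x : C x -> V x by move=> /connected_component_sub[].
have CD : C `<=` D.
  move=> x [B [Bp BV conB] Bx]; exists B => //; split => //.
  by apply: subset_trans BV _ => z [/VK].
suff CeD : C = D by rewrite -/D -CeD; exact: CV.
apply: (component_connected (A := K `\` A) (x := p)).
- by exists p; exact: connected_component_refl.
- exists ([set y | V y -> C y]° `&` ~` W).
    by apply: openI; [exact: open_interior | exact: closed_openC].
  apply/seteqP; split => [x Cx|x [Dx [/interior_subset /= VC nWx]]].
    split; [exact: CD | split]; last first.
      by move=> Wx; have : (C `&` W) x by []; rewrite CW0.
    have [Vx nAx] := connected_component_sub Cx.
    rewrite /interior /=; apply: filterS (component_near fV clA Vx nAx) => y Cy Vy.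
    exact: connected_component_trans Cx (Cy Vy).
  by apply: VC; have [/KVW[]] := connected_component_sub Dx.
(* As [V] is closed and contains [C], this set is the closure of [C]. *)
- exists (V `&` ~` [set y | V y -> ~ C y]°).
    by apply: closedI => //; apply: open_closedC; exact: open_interior.
  apply/seteqP; split => [x Cx|x [Dx [Vx nx]]].
    split; [exact: CD | split; first exact: CV].
    by move=> /interior_subset /= /(_ (CV _ Cx)).
  apply: contrapT => nCx; apply: nx; have [_ nAx] := connected_component_sub Dx.
  rewrite /interior /=; apply: filterS (component_near fV clA Vx nAx) => y xy Vy Cy.
  apply: nCx; apply: connected_component_trans Cy _.
  by apply: connected_component_sym; exact: xy.
Qed.

(** Every component contains a listed point of [V] and [W], so there are no more components than
    entries in the list. *)
Lemma num_components_bound A V W M :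
    (forall p, V p -> ~ A p -> connected_component (V `\` A) p `&` W !=set0) ->
    card_at_most M (V `&` W) ->
  exists2 k, (k <= M)%N & num_components (V `\` A) = k%:R%:E.
Proof.
move=> meet [s sM VWs]; set X := connected_component (V `\` A) @` (V `\` A).
have Xs : X `<=` [set` map (connected_component (V `\` A)) s].
  move=> _ [p [Vp nAp] <-]; have [q [Cq Wq]] := meet _ Vp nAp.
  rewrite (same_connected_component Cq); apply/map_f/VWs; split => //.
  by have [] := connected_component_sub Cq.
have fX : finite_set X by apply: sub_finite_set Xs _; exact: finite_seq.
exists #|` fset_set X|; last by rewrite /num_components /counting asboolT.
apply: leq_trans sM; rewrite -(size_map (connected_component (V `\` A))).
apply: uniq_leq_size; first exact: fset_uniq.
by move=> C; rewrite in_fset_set // inE => /Xs.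
Qed.

Theorem N_C_eventually K A (V W : nat -> set E) (M : nat) :
    compact K -> connected K -> closed A -> A !=set0 -> A `<=` K ->
    (forall n, continuum_nbhd K A (V n)) ->
    (forall n, V n.+1 `<=` V n) ->
    (forall O, open O -> A `<=` O -> exists n, V n `<=` O) ->
    (forall n, finely_connected (V n)) ->
    (forall n, closed (W n)) -> (forall n, K `<=` V n `|` W n) ->
    (forall n, card_at_most M (V n `&` W n)) ->
  exists n0, forall n, (n0 <= n)%N -> num_components (V n `\` A) = N_C K A.
Proof.
move=> cK conK clA A0 AK nV decV shrV fV clW KVW cVW.
have decV' m n : (m <= n)%N -> V n `<=` V m.
  move=> /subnK <-; elim: (n - m)%N => [//|k IH].
  by rewrite addSn; exact: subset_trans (decV _) IH.
have nK : continuum_nbhd K A K.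
  by split => // a Aa; apply: filterE.
have le_NC V' : continuum_nbhd K A V' -> (num_components (V' `\` A) <= N_C K A)%E.
  by move=> nV'; apply: ereal_sup_ubound; exists V'.
have VleV m n : (m <= n)%N ->
    (num_components (V m `\` A) <= num_components (V n `\` A))%E.
  by move=> mn; apply: (@num_components_antitone K) => //; exact: decV'.
have VK n : V n `<=` K by have [] := nV n.
set X := connected_component (K `\` A) @` (K `\` A).
have [fX|infX] := pselect (finite_set X); last first.
  have Koo : num_components (K `\` A) = +oo%E.
    by rewrite /num_components /counting asboolF.
  have NCoo : N_C K A = +oo%E by apply/eqP; rewrite -leye_eq -Koo; exact: le_NC.
  exists 0%N => n _; apply/eqP; rewrite NCoo -leye_eq -Koo.
  exact: (@num_components_antitone K).
(* One point is marked in each of the finitely many components of [K \ A]. Once [V n] avoids all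
   marked points, it contains no whole component. *)
have [pt ptX] : exists pt : set E -> E, forall C, X C -> C (pt C).
  suff /boolp.choice[pt ptX] C : exists p, X C -> C p by exists pt.
  have [[p KAp <-]|nXC] := pselect (X C); last by exists 0.
  by exists p => _; exact: connected_component_refl.
have oX : open (~` (pt @` X)).
  apply: closed_openC; apply: (accessible_finite_set_closed.1 _); last exact: finite_image.
  exact: hausdorff_accessible.
have [|n1 Vn1] := shrV _ oX.
  move=> a Aa [C XC ptC]; have := ptX _ XC; rewrite ptC.
  by case: XC => p _ <- /connected_component_sub[].
have meet n p : (n1 <= n)%N -> V n p -> ~ A p ->
    connected_component (V n `\` A) p `&` W n !=set0.
  move=> n1n Vp nAp; apply/set0P/eqP => CW0.
  have [_ cV _ _] := nV n.
  have clV : closed (V n) by exact: compact_closed.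
  have KAX : X (connected_component (K `\` A) p) by exists p => //; split => //; exact: VK Vp.
  have := component_trapped (fV n) clV (clW n) clA (VK n) (KVW n) Vp nAp CW0.
  by move=> /(_ _ (ptX _ KAX)) /(decV' _ _ n1n) /Vn1; apply; exists (connected_component (K `\` A) p).
(* The counts are bounded by [M] from [n1] on, so a largest value [k] is attained; as they also
   increase with [n], they stay at [k] afterwards. *)
pose P k := `[< exists2 n, (n1 <= n)%N & num_components (V n `\` A) = k%:R%:E >].
have bnd n : (n1 <= n)%N ->
    exists2 k, (k <= M)%N & num_components (V n `\` A) = k%:R%:E.
  by move=> n1n; apply: num_components_bound (cVW n) => p; exact: meet.
have exP : exists k, P k.
  by have [k _ kE] := bnd _ (leqnn n1); exists k; apply/asboolP; exists n1.
have ubP k : P k -> (k <= M)%N.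
  move=> /asboolP[n n1n nk]; have [k' k'M] := bnd _ n1n.
  by rewrite nk => -[/eqP]; rewrite eqr_nat => /eqP ->.
have [k /asboolP[n0 n1n0 n0k] kmax] := ex_maxnP exP ubP.
have stab n : (n0 <= n)%N -> num_components (V n `\` A) = k%:R%:E.
  move=> n0n; apply/eqP; rewrite eq_le; apply/andP; split; last first.
    by rewrite -n0k; exact: VleV.
  have n1n := leq_trans n1n0 n0n.
  have [k' _ nk'] := bnd _ n1n; rewrite nk' lee_fin ler_nat; apply: kmax.
  by apply/asboolP; exists n.
exists n0 => n n0n; apply/eqP; rewrite eq_le le_NC //=.
apply: ge_ereal_sup => _ [V' nV' <-].
(* Any competitor [V'] contains some [V n] with [n] past [n0], so its count is at most [k]. *)
have [_ _ _ /set_nbhsP[G [oO AO OV']]] := nV'.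
have [m VmO] := shrV _ oO AO.
rewrite stab // -(stab (maxn n0 m)) ?leq_maxl //.
apply: (@num_components_antitone K) => // x Vx.
by apply: OV'; [apply/VmO/(decV' _ _ (leq_maxr n0 m)) | exact: VK Vx].
Qed.

End Euclid.

(** * Euclidean distance, similarities and separated sets *)

Section EuclideanDistance.
Context {R : realType} {d : nat}.
Local Notation E := 'rV[R]_d.
Implicit Types (x y u v : E).

Definition dot u v : R := (u *m v^T) 0 0.

Lemma dotE u v : dot u v = \sum_(k < d) u 0 k * v 0 k.
Proof. by rewrite /dot mxE; apply: eq_bigr => k _; rewrite mxE. Qed.

Lemma euclid_distE x y : euclid_dist x y = Num.sqrt (dot (x - y) (x - y)).
Proof.
by rewrite dotE /euclid_dist; congr Num.sqrt; apply: eq_bigr => k _; rewrite !mxE expr2.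
Qed.

Lemma dot_ge0 u : 0 <= dot u u.
Proof. by rewrite dotE; apply: sumr_ge0 => k _; rewrite -expr2 sqr_ge0. Qed.

Lemma euclid_dist_ge0 x y : 0 <= euclid_dist x y.
Proof. exact: sqrtr_ge0. Qed.

Lemma norm_le_euclid_dist x y : `|x - y| <= euclid_dist x y.
Proof.
rewrite [leLHS]/Num.Def.normr /= mx_normrE; apply/bigmax_leP; split; first exact: euclid_dist_ge0.
move=> [i k] _; rewrite (ord1 i) !mxE /= -sqrtr_sqr ler_wsqrtr //.
by rewrite (bigD1 k) //= lerDl sumr_ge0 // => j _; rewrite sqr_ge0.
Qed.

(** Comparison constant between the Euclidean and sup norms; the added 1 keeps it positive when [d]
    is 0. *)
Definition euclid_const : R := Num.sqrt d%:R + 1.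

Lemma euclid_const_gt0 : 0 < euclid_const.
Proof. by rewrite ltr_wpDl // sqrtr_ge0. Qed.

Lemma euclid_dist_le x y : euclid_dist x y <= euclid_const * `|x - y|.
Proof.
apply: (@le_trans _ _ (Num.sqrt d%:R * `|x - y|)); last first.
  by rewrite ler_wpM2r // lerDl.
rewrite -[X in _ * X]ger0_norm // -sqrtr_sqr -sqrtrM // ler_wsqrtr //.
rewrite mulr_natl -[X in _ *+ X]card_ord -sumr_const ler_sum // => k _.
rewrite -[leLHS]real_normK ?num_real // lerXn2r ?nnegrE //.
rewrite [leRHS]/Num.Def.normr /= mx_normrE.
apply: le_trans (@le_bigmax _ R _ 0 (fun i : 'I_1 * 'I_d => `|(x - y) i.1 i.2|) (ord0, k)).
by rewrite /= !mxE.
Qed.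

Lemma similarity_surj (r : R) (f : E -> E) : 0 < r ->
    (forall x y, euclid_dist (f x) (f y) = r * euclid_dist x y) ->
  forall y, exists x, f x = y.
Proof.
(* The normalised map [g] preserves inner products, so it is [x |-> x *m G] with [G] orthogonal. *)
move=> r0 fr; have rN0 : r != 0 by rewrite gt_eqF.
pose g x := r^-1 *: (f x - f 0).
have dotBB u v : dot (u - v) (u - v) = dot u u + dot v v - 2 * dot u v.
  by rewrite !dotE mulr_sumr -!big_split -sumrB /=; apply: eq_bigr => k _; rewrite !mxE; ring.
have dotgB x y : dot (g x - g y) (g x - g y) = dot (x - y) (x - y).
  have /(congr1 (fun t => t ^+ 2)) := fr x y.
  rewrite exprMn !euclid_distE !sqr_sqrtr ?dot_ge0 // => fxy.
  apply: (@mulfI _ (r ^+ 2)); first by rewrite expf_neq0.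
  rewrite -fxy /g -scalerBr !dotE mulr_sumr; apply: eq_bigr => k _.
  by rewrite !mxE; field.
have g0 : g 0 = 0 by rewrite /g subrr scaler0.
have dotgg x : dot (g x) (g x) = dot x x by have := dotgB x 0; rewrite g0 !subr0.
have dotg x y : dot (g x) (g y) = dot x y.
  by have := dotgB x y; rewrite !dotBB !dotgg; lra.
pose G : 'M[R]_d := \matrix_i g (delta_mx 0 i).
(* The rows of [G] are the images of the basis vectors, so pairing [g x] with them returns the
   coordinates of [x]. *)
have gG x : g x *m G^T = x.
  apply/rowP => j; transitivity (dot x (delta_mx 0 j)).
    by rewrite -dotg dotE mxE; apply: eq_bigr => k _; rewrite !mxE.
  rewrite dotE (bigD1 j) //= big1 ?mxE ?eqxx ?mulr1 ?addr0 // => k kj.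
  by rewrite mxE (negbTE kj) andbF mulr0.
have GGt : G *m G^T = 1%:M.
  by apply/row_matrixP => i; rewrite row_mul rowK gG row1.
have GtG := mulmx1C GGt.
move=> y; exists ((r^-1 *: (y - f 0)) *m G^T).
have : g ((r^-1 *: (y - f 0)) *m G^T) = r^-1 *: (y - f 0).
  by rewrite -[LHS]mulmx1 -GtG mulmxA gG -mulmxA GtG mulmx1.
by move/(scalerI (invr_neq0 rN0))/addIr.
Qed.

(** Finitely many balls of radius [c / 2] cover the compact ball of radius [C], and each contains at
    most one point of the list. *)
Lemma separated_seq_bound (C c : R) : 0 < c ->
  exists N, forall s : seq E, uniq s -> (forall x, x \in s -> `|x| <= C) ->
    {in s &, forall x y, x != y -> c <= `|x - y|} -> (size s <= N)%N.
Proof.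
move=> c0; pose B := [set x : E | `|x| <= C].
have cB : compact B.
  apply: bounded_closed_compact.
    by exists C; split; [exact: num_real | move=> M CM x /le_trans; apply; exact: ltW].
  have -> : B = Num.Def.normr @^-1` [set t : R | t <= C] by [].
  by apply: (preimage_closed _ (@closed_le _ _)) => x _; exact: norm_continuous.
rewrite compact_cover in cB.
have c20 : 0 < c / 2 by rewrite divr_gt0.
have [||D _ BD] := cB E B (fun x => ball x (c / 2)).
- by move=> x _; exact: ball_open.
- by move=> x Bx; exists x => //; exact: ballxx.
exists (size D) => s us sC sc.
suff /boolp.choice[f fP] x : exists z, x \in s -> z \in D /\ ball z (c / 2) x.
  have inj : {in s &, injective f}.
    move=> x y xs ys fxy; apply/eqP; apply: contrapT => /negP xy.
    have [_ fx] := fP _ xs; have [_ fy] := fP _ ys.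
    have := sc _ _ xs ys xy; apply/negP; rewrite -ltNge.
    rewrite fxy in fx; have := ball_splitr fx fy.
    by rewrite -ball_normE.
  rewrite -(size_map f); apply: uniq_leq_size; first by rewrite map_inj_in_uniq.
  by move=> z /mapP[x xs ->]; have [] := fP _ xs.
have [xs|] := boolP (x \in s); last by exists 0.
by have [z /= zD zx] := BD _ (sC _ xs); exists z.
Qed.

End EuclideanDistance.

(** * Cardinality bounds and thresholds common to finitely many conditions *)

Section CardAtMost.

Lemma card_at_mostP (T : choiceType) n (A : set T) :
  (forall s : seq T, uniq s -> [set` s] `<=` A -> (size s <= n)%N) -> card_at_most n A.
Proof.
move=> sn; have [fA|infA] := pselect (finite_set A).
  exists (fset_set A); last by move=> x Ax; rewrite /= in_fset_set // inE.
  by apply: sn; [exact: fset_uniq | move=> x /=; rewrite in_fset_set // inE].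
have [X XA nX] := infinite_set_fset n.+1 infA.
by have := sn X (fset_uniq X) XA; rewrite leqNgt nX.
Qed.

Lemma card_at_most_II (T : choiceType) n (A : set T) :
  (A #<= `I_n)%card -> card_at_most n A.
Proof.
move=> An; have fA : finite_set A by apply/finite_set_leP; exists n.
exists (fset_set A); first exact: geq_card_fset_set.
by move=> x Ax; rewrite /= in_fset_set // inE.
Qed.

Lemma card_at_most_finite (T : choiceType) n (A : set T) : card_at_most n A -> finite_set A.
Proof. by move=> [s _ As]; apply: sub_finite_set As _; exact: finite_seq. Qed.

Lemma card_at_most_sub (T : eqType) n (A B : set T) :
  A `<=` B -> card_at_most n B -> card_at_most n A.
Proof. by move=> AB [s sn Bs]; exists s => // x /AB/Bs. Qed.

Lemma card_at_most_image (T U : eqType) n (A : set T) (f : T -> U) :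
  card_at_most n A -> card_at_most n (f @` A).
Proof.
move=> [s sn As]; exists (map f s); first by rewrite size_map.
by move=> _ [x Ax <-]; apply/map_f/As.
Qed.

Lemma card_at_most_bigcup (T U : choiceType) m n (A : set T) (F : T -> set U) :
    card_at_most m A -> (forall x, A x -> card_at_most n (F x)) ->
  card_at_most (m * n) (\bigcup_(x in A) F x).
Proof.
move=> [s sm As] Fn.
suff /boolp.choice[t tP] x : exists t : seq U, (size t <= n)%N /\ (A x -> F x `<=` [set` t]).
  exists (flatten (map t s)); last first.
    move=> y [x Ax Fxy]; apply/flatten_mapP; exists x; first exact: As.
    exact: (tP x).2.
  apply: (@leq_trans (size s * n)); last by rewrite leq_mul2r sm orbT.
  elim: s {sm As} => //= x s IH; rewrite size_cat mulSn leq_add //.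
  exact: (tP x).1.
have [/Fn[t tn Ft]|nAx] := pselect (A x); first by exists t.
by exists [::].
Qed.

Lemma eventually_forall_seq (T : eqType) (s : seq T) (P : T -> nat -> Prop) :
    (forall x, x \in s -> exists n0, forall n, (n0 <= n)%N -> P x n) ->
  exists n0, forall n, (n0 <= n)%N -> forall x, x \in s -> P x n.
Proof.
elim: s => [|x s IH] sP; first by exists 0%N.
have [n1 Pn1] := sP x (mem_head x s).
have [|n2 Pn2] := IH; first by move=> y ys; apply: sP; rewrite inE ys orbT.
exists (maxn n1 n2) => n; rewrite geq_max => /andP[n1n n2n] y.
by rewrite inE => /predU1P[->|ys]; [exact: Pn1 | exact: Pn2].
Qed.

Lemma eventually_forall_pairs (T : choiceType) (A : set T) (P : T -> T -> nat -> Prop) :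
    finite_set A ->
    (forall x y, A x -> A y -> exists n0, forall n, (n0 <= n)%N -> P x y n) ->
  exists n0, forall n, (n0 <= n)%N -> forall x y, A x -> A y -> P x y n.
Proof.
move=> fA AP; pose s := fset_set A.
have sA x : x \in s -> A x by rewrite in_fset_set // inE.
have As x : A x -> x \in s by rewrite in_fset_set // inE.
have [|n0 H] := @eventually_forall_seq _ s (fun x n => forall y, y \in s -> P x y n).
  by move=> x /sA Ax; apply: eventually_forall_seq => y /sA; exact: AP.
by exists n0 => n n0n x y /As xs /As ys; exact: H.
Qed.

End CardAtMost.

(** * Prefixes of finite and infinite words *)

Section Words.
Context {T : eqType}.
Implicit Types (u v w : seq T) (al be : nat -> T).

Lemma take_mkseq al k n : (k <= n)%N -> take k (mkseq al n) = mkseq al k.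
Proof. by move=> kn; rewrite /mkseq -map_take take_iota (minn_idPl kn). Qed.

Lemma prefix_mkseq al u n : prefix u (mkseq al n) -> u = mkseq al (size u).
Proof.
move=> /[dup] /size_prefix; rewrite size_mkseq => un.
by rewrite prefixE take_mkseq // => /eqP.
Qed.

Lemma mkseq_eq_le al be k n : (k <= n)%N ->
  mkseq al n = mkseq be n -> mkseq al k = mkseq be k.
Proof. by move=> kn /(congr1 (take k)); rewrite !take_mkseq. Qed.

Lemma mkseq_neq al be : al <> be ->
  exists n0, forall n, (n0 <= n)%N -> mkseq al n <> mkseq be n.
Proof.
move=> albe; have [k kP] : exists k, al k <> be k.
  by apply/existsNP => H; apply: albe; apply/funext.
exists k.+1 => n kn /(mkseq_eq_le kn); rewrite !mkseqS => /rcons_inj[_].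
exact: kP.
Qed.

Lemma incomparable_split u v : ~~ prefix u v -> ~~ prefix v u ->
  exists c a b u' v', [/\ a != b, u = c ++ a :: u' & v = c ++ b :: v'].
Proof.
elim: u v => [|a u IH] [|b v] //=.
have [<-{b}|ab _ _] := eqVneq a b; last by exists [::], a, b, u, v.
move=> uv vu; have [c [a' [b' [u' [v' [ab -> ->]]]]]] := IH _ uv vu.
by exists (a :: c), a', b', u', v'.
Qed.

Lemma prefix_size_eq u v : prefix u v -> size u = size v -> u = v.
Proof. by move=> + uv; rewrite prefixE uv take_size => /eqP. Qed.

End Words.

(** * Contraction ratios, cut sets and addresses *)

Section Pieces.
Context {R : realType} {d m : nat}.
Local Notation E := 'rV[R]_d.
Variables (S : 'I_m -> E -> E) (K : set E) (r : 'I_m -> R).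
Hypotheses (r_gt0 : forall a, 0 < r a) (r_lt1 : forall a, r a < 1).
Hypothesis S_sim : forall a x y, euclid_dist (S a x) (S a y) = r a * euclid_dist x y.
Hypothesis attK : is_attractor S K.
Implicit Types (u v w : seq 'I_m) (al be : nat -> 'I_m) (x y : E).

Definition word_ratio w : R := \prod_(a <- w) r a.

Definition address al x := forall n, piece S K (mkseq al n) x.

Lemma word_ratio_gt0 w : 0 < word_ratio w.
Proof. by apply: prodr_gt0 => a _. Qed.

Lemma word_ratio_cat u v : word_ratio (u ++ v) = word_ratio u * word_ratio v.
Proof. by rewrite /word_ratio big_cat. Qed.

Lemma word_ratio_rcons u a : word_ratio (rcons u a) = word_ratio u * r a.
Proof. by rewrite -cats1 word_ratio_cat /word_ratio big_seq1. Qed.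

Lemma word_map_cat u v : word_map S (u ++ v) = word_map S u \o word_map S v.
Proof. by elim: u => //= a u ->. Qed.

Lemma word_map_dist w x y :
  euclid_dist (word_map S w x) (word_map S w y) = word_ratio w * euclid_dist x y.
Proof.
elim: w => [|a w IH]; first by rewrite /word_ratio big_nil mul1r.
by rewrite /= S_sim IH mulrA /word_ratio big_cons.
Qed.

Lemma word_map_surj w y : exists x, word_map S w x = y.
Proof. exact: similarity_surj (word_ratio_gt0 w) (word_map_dist w) y. Qed.

Lemma ratio_bounds : exists q : R,
  [/\ 0 < q, q < 1, forall a, q <= r a & forall a, r a <= 1 - q].
Proof.
suff [q [q0 q1 qr]] : exists q : R, [/\ 0 < q, q < 1 &
    forall a, a \in enum 'I_m -> q <= r a /\ r a <= 1 - q].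
  by exists q; split => // a; have [] := qr a (mem_enum _ _).
(* The value 1/2 for the empty list also settles an empty alphabet. *)
elim: (enum _) => [|a s [q [q0 q1 qs]]]; first by exists (1 / 2); split => //; lra.
have ra0 := r_gt0 a; have ra1 := r_lt1 a.
exists (Num.min q (Num.min (r a) (1 - r a))); split.
- by rewrite !lt_min q0 ra0 subr_gt0.
- by rewrite gt_min q1.
- move=> b; rewrite inE lerBrDr -lerBrDl => /predU1P[->|/qs[qb bq]].
    by rewrite !ge_min !lexx !orbT.
  by rewrite !ge_min qb lerBrDr -lerBrDl bq.
Qed.

Lemma word_ratio_le1 w : word_ratio w <= 1.
Proof.
elim/last_ind: w => [|w a IH]; first by rewrite /word_ratio big_nil.
by rewrite word_ratio_rcons mulr_ile1 // ltW // word_ratio_gt0.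
Qed.

Lemma word_ratio_lt1 w : w != [::] -> word_ratio w < 1.
Proof.
case: w => // a w _; rewrite /word_ratio big_cons.
apply: le_lt_trans (r_lt1 a); rewrite ler_piMr //; first exact: ltW.
exact: word_ratio_le1.
Qed.

Lemma word_ratio_lt_prefix u w : prefix u w -> u != w -> word_ratio w < word_ratio u.
Proof.
move=> /prefixP[v ->] uv; rewrite word_ratio_cat gtr_pMr ?word_ratio_gt0 //.
by apply: word_ratio_lt1; apply: contraNneq uv => ->; rewrite cats0.
Qed.

Lemma word_ratio_le_exp q w : (forall a, r a <= 1 - q) -> word_ratio w <= (1 - q) ^+ size w.
Proof.
move=> rq; elim: w => [|a w IH]; first by rewrite /word_ratio big_nil.
by rewrite /word_ratio big_cons exprS ler_pM // ltW // word_ratio_gt0.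
Qed.

Lemma exp_le_word_ratio q w : 0 < q -> (forall a, q <= r a) -> q ^+ size w <= word_ratio w.
Proof.
move=> q0 qr; elim: w => [|a w IH]; first by rewrite /word_ratio big_nil.
by rewrite /word_ratio big_cons exprS ler_pM // ?exprn_ge0 // ltW.
Qed.

Lemma word_ratio_eventually_lt (e : R) : 0 < e ->
  exists n0, forall w, (n0 <= size w)%N -> word_ratio w < e.
Proof.
move=> e0; have [q [q0 q1 _ rq]] := ratio_bounds.
have q1' : `|1 - q| < 1 by rewrite ger0_norm; lra.
have [n0 _ H] := (cvgr0Pnorm_lt _).1 (cvg_expr q1') e e0.
exists n0 => w n0w; apply: le_lt_trans (word_ratio_le_exp w rq) _.
by apply: le_lt_trans (ler_norm _) _; exact: H.
Qed.

(* Words of equal length need not have comparable ratios, but the words of a cut set do. *)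
Definition cut_set (rho : R) : set (seq 'I_m) :=
  [set w | word_ratio w <= rho /\ forall u, prefix u w -> u != w -> rho < word_ratio u].

(** This makes it possible to compare a given piece with the other pieces of the same scale. *)
Lemma cut_ratio w : cut_set (word_ratio w) w.
Proof. by split => // u uw une; exact: word_ratio_lt_prefix. Qed.

Lemma cut_prefix rho u w : cut_set rho u -> cut_set rho w -> prefix u w -> u = w.
Proof.
move=> [urho _] [_ wP] uw; apply/eqP; apply: contraT => une.
by have := wP _ uw une; rewrite ltNge urho.
Qed.

(** Without its last letter the word has ratio above [rho], and that letter contributes at least
    [q]. The empty word is the case that requires [rho <= 1]. *)
Lemma cut_ratio_ge rho q w : 0 < rho -> rho <= 1 -> 0 < q -> q < 1 -> (forall a, q <= r a) ->
  cut_set rho w -> q * rho <= word_ratio w.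
Proof.
move=> rho0 rho1 q0 q1 qr; elim/last_ind: w => [|w a _] [_ wP].
  by rewrite /word_ratio big_nil mulr_ile1 // ltW.
rewrite word_ratio_rcons mulrC ler_pM // ltW //; apply: wP; first exact: prefix_rcons.
by apply/eqP => /(congr1 size)/eqP; rewrite size_rcons -[X in X == _]addn0 -addn1 eqn_add2l.
Qed.

(** The shortest initial segment of [al] with ratio at most [rho] works. *)
Lemma cut_exists rho al : 0 < rho -> exists n, cut_set rho (mkseq al n).
Proof.
move=> rho0; have [n0 n0P] := word_ratio_eventually_lt rho0.
have ex : exists n, word_ratio (mkseq al n) <= rho.
  by exists n0; rewrite ltW // n0P // size_mkseq.
have [n nP nmin] := ex_minnP ex; exists n; split => // u un une.
rewrite ltNge; apply: contra une => urho.
have := size_prefix un; rewrite size_mkseq leq_eqVlt => /predU1P[un'|].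
  by rewrite (prefix_mkseq un) un'.
by rewrite ltnNge nmin // -(prefix_mkseq un).
Qed.

Lemma word_map_attractor w : word_map S w @` K `<=` K.
Proof.
have [_ _ KE] := attK; elim: w => [|a w IH] _ [x Kx <-] //=.
by rewrite KE; exists a => //; exists (word_map S w x) => //; apply: IH; exists x.
Qed.

Lemma piece_sub w : piece S K w `<=` K.
Proof. exact: word_map_attractor. Qed.

Lemma piece0 : piece S K [::] = K.
Proof. by rewrite /piece /= image_id. Qed.

Lemma piece_cat u v : piece S K (u ++ v) `<=` piece S K u.
Proof.
move=> _ [x Kx <-]; rewrite word_map_cat; exists (word_map S v x) => //.
by apply: word_map_attractor; exists x.
Qed.

Lemma piece_prefix u w : prefix u w -> piece S K w `<=` piece S K u.
Proof. by move=> /prefixP[v ->]; exact: piece_cat. Qed.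

Lemma piece_take n w : piece S K w `<=` piece S K (take n w).
Proof. by apply: piece_prefix; exact: prefix_take. Qed.

Lemma piece_rcons w x : piece S K w x -> exists a, piece S K (rcons w a) x.
Proof.
have [_ _ KE] := attK => -[y Ky <-].
have [a _ [z Kz <-]] : (\bigcup_(a in [set: 'I_m]) S a @` K) y by rewrite -KE.
by exists a; exists z => //; rewrite -cats1 word_map_cat.
Qed.

Lemma address_extension w x : piece S K w x ->
  exists al, mkseq al (size w) = w /\ address al x.
Proof.
move=> wx; have [a0 _] := piece_rcons wx.
suff /boolp.choice[nxt nxtP] u : exists a, piece S K u x -> piece S K (rcons u a) x.
  (* The next letter is read from [w] while it lasts, and afterwards chosen to keep [x] in the
     piece. It depends on the whole word so far, so the prefixes [pre] are built first and [al] is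
     read off them. *)
  pose h u := if (size u < size w)%N then nth a0 w (size u) else nxt u.
  pose pre := fix pre n := if n is n'.+1 then rcons (pre n') (h (pre n')) else [::].
  have size_pre n : size (pre n) = n by elim: n => //= n IH; rewrite size_rcons IH.
  pose al n := h (pre n).
  have mkE n : mkseq al n = pre n by elim: n => // n IH; rewrite mkseqS IH.
  have preE n : (n <= size w)%N -> pre n = take n w.
    elim: n => [|n IH] nw; first by rewrite take0.
    by rewrite (take_nth a0) //= IH ?(ltnW nw) // /h size_take nw nw.
  exists al; rewrite mkE preE // take_size; split => // n; rewrite mkE.
  elim: n => [|n IH] /=; first by rewrite piece0; exact: piece_sub wx.
  have [nw|wn] := ltnP n (size w).
    by have := preE _ nw => /= ->; exact: piece_take wx.
  by rewrite /h size_pre ltnNge wn /=; exact: nxtP.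
have [/piece_rcons[a ax]|nux] := pselect (piece S K u x); first by exists a.
by exists a0.
Qed.

Lemma piece_words n w x : piece S K w x -> (size w <= n)%N ->
  exists v, [/\ size v = n, prefix w v & piece S K v x].
Proof.
move=> /address_extension[al [alw alx]] wn; exists (mkseq al n); split => //.
  by rewrite size_mkseq.
by rewrite prefixE take_mkseq // alw.
Qed.

End Pieces.

(** * Size, topology and intersections of pieces *)

Section PieceGeometry.
Context {R : realType} {d m : nat}.
Local Notation E := 'rV[R]_d.
Variables (S : 'I_m -> E -> E) (K : set E) (r : 'I_m -> R).
Hypotheses (r_gt0 : forall a, 0 < r a) (r_lt1 : forall a, r a < 1).
Hypothesis S_sim : forall a x y, euclid_dist (S a x) (S a y) = r a * euclid_dist x y.
Hypothesis attK : is_attractor S K.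
Implicit Types (u v w : seq 'I_m) (al be : nat -> 'I_m) (x y : E).
Local Notation word_ratio := (word_ratio r).
Local Notation cut_set := (cut_set r).
Local Notation address := (address S K).

Lemma word_map_norm_le w x y :
  `|word_map S w x - word_map S w y| <= word_ratio w * (euclid_const (R := R) (d := d) * `|x - y|).
Proof.
apply: le_trans (norm_le_euclid_dist _ _) _; rewrite (word_map_dist S_sim).
by rewrite ler_pM2l ?word_ratio_gt0 //; exact: euclid_dist_le.
Qed.

Lemma word_map_inj w : injective (word_map S w).
Proof.
move=> x y wxy; have := word_map_dist S_sim w x y.
rewrite wxy euclid_distE subrr dotE big1 => [|k _]; last by rewrite !mxE mul0r.
rewrite sqrtr0 => /esym/eqP; rewrite mulf_eq0 gt_eqF ?word_ratio_gt0 //= => /eqP xy0.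
apply/eqP; rewrite -subr_eq0 -normr_le0 -xy0; exact: norm_le_euclid_dist.
Qed.

Lemma word_map_continuous w : continuous (word_map S w).
Proof.
move=> x; apply: (iffRL (@cvgrPdist_lt _ _ _ (nbhs x) _ _ _)) => e e0.
have c0 := euclid_const_gt0 (R := R) (d := d).
have w0 := word_ratio_gt0 r_gt0 w.
have ew0 : 0 < e / (word_ratio w * euclid_const (R := R) (d := d)) by rewrite divr_gt0 // mulr_gt0.
have := nbhsx_ballx x _ ew0.
apply: filterS => y; rewrite -ball_normE /ball_ /= ltr_pdivlMr ?mulr_gt0 // => xy.
apply: le_lt_trans (word_map_norm_le _ _ _) _.
by rewrite mulrA mulrC.
Qed.

Lemma compactK : compact K.
Proof. by have [] := attK. Qed.

Lemma piece_compact w : compact (piece S K w).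
Proof.
apply: continuous_compact compactK.
by apply: continuous_subspaceT; exact: word_map_continuous.
Qed.

Lemma piece_closed w : closed (piece S K w).
Proof. by apply: compact_closed; [exact: norm_hausdorff | exact: piece_compact]. Qed.

Lemma piece_connected w : connected K -> connected (piece S K w).
Proof.
move=> conK; apply: connected_continuous_connected => //.
by apply: continuous_subspaceT; exact: word_map_continuous.
Qed.

Lemma piece_nonempty w : piece S K w !=set0.
Proof. by have [[x Kx] _ _] := attK; exists (word_map S w x); exists x. Qed.

Lemma attractor_norm_bound : exists2 B : R, 0 < B & forall x, K x -> `|x| <= B.
Proof.
have [B [_ KB]] := compact_bounded compactK.
exists (Num.max B 0 + 1); first by rewrite ltr_wpDl // le_max lexx orbT.
by move=> x; apply: KB; rewrite ltr_pwDr // le_max lexx.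
Qed.

(** The point [p] may lie outside [K]: it is taken to be 0 for diameters, and a point of the open
    set for the counting argument. *)
Lemma piece_norm_bound (p : E) : exists2 D : R, 0 < D &
  forall w x, piece S K w x -> `|word_map S w p - x| <= word_ratio w * D.
Proof.
have [B B0 KB] := attractor_norm_bound.
have c0 := euclid_const_gt0 (R := R) (d := d).
exists (euclid_const (R := R) (d := d) * (`|p| + B)).
  by rewrite mulr_gt0 // ltr_wpDl.
move=> w _ [x Kx <-]; apply: le_trans (word_map_norm_le _ _ _) _.
rewrite ler_pM2l ?word_ratio_gt0 // ler_pM2l //.
by apply: le_trans (ler_normB _ _) _; rewrite lerD2l; exact: KB.
Qed.

Lemma piece_diameter : exists2 D : R, 0 < D &
  forall w x y, piece S K w x -> piece S K w y -> `|x - y| <= word_ratio w * D.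
Proof.
have [D D0 DP] := piece_norm_bound 0; exists (D + D); first exact: addr_gt0.
move=> w x y wx wy; rewrite mulrDr.
apply: le_trans (ler_distD (word_map S w 0) _ _) _.
by apply: lerD; [rewrite distrC|]; exact: DP.
Qed.

Lemma piece_ball (e : R) : 0 < e -> exists n0, forall w, (n0 <= size w)%N ->
  forall x y, piece S K w x -> piece S K w y -> ball x e y.
Proof.
move=> e0; have [D D0 DP] := piece_diameter.
have [n0 n0P] := word_ratio_eventually_lt r_gt0 r_lt1 (divr_gt0 e0 D0).
exists n0 => w n0w x y wx wy; rewrite -ball_normE /ball_ /=.
by apply: le_lt_trans (DP _ _ _ wx wy) _; rewrite -ltr_pdivlMr //; exact: n0P.
Qed.

Lemma piece_separates x y : x <> y -> exists n0, forall w, (n0 <= size w)%N ->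
  piece S K w x -> ~ piece S K w y.
Proof.
move=> /eqP xy; have e0 : 0 < `|x - y| by rewrite normr_gt0 subr_eq0.
have [n0 n0P] := piece_ball e0; exists n0 => w n0w wx wy.
by have := n0P _ n0w _ _ wx wy; rewrite -ball_normE /ball_ /= ltxx.
Qed.

Lemma address_unique al x y : address al x -> address al y -> x = y.
Proof.
move=> alx aly; apply: contrapT => /piece_separates[n0 /(_ (mkseq al n0))].
by rewrite size_mkseq => /(_ (leqnn _) (alx _)); apply; exact: aly.
Qed.

(** Nested nonempty compact pieces have a common point: otherwise [compact_directed_sub] with the
    empty open set would make one of them empty. *)
Lemma address_exists al : exists x, address al x.
Proof.
apply: contrapT => nex; pose F := range (fun n => piece S K (mkseq al n)).
have subF k n : (k <= n)%N -> piece S K (mkseq al n) `<=` piece S K (mkseq al k).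
  by move=> kn; rewrite -(take_mkseq al kn); exact: piece_take.
have F0 : F !=set0 by exists (piece S K (mkseq al 0)); exists 0%N.
have Fcl D : F D -> compact D /\ closed D.
  by case=> n _ <-; split; [exact: piece_compact | exact: piece_closed].
have FI D1 D2 : F D1 -> F D2 -> F (D1 `&` D2).
  move=> [i _ <-] [j _ <-].
  wlog ij : i j / (i <= j)%N.
    by move=> H; have [/H//|/ltnW/H] := leqP i j; rewrite setIC.
  by rewrite setIidr; [exists j | exact: subF].
have [|D [n _ <-] H] := compact_directed_sub F0 Fcl FI open0.
  by move=> x Fx; apply: nex; exists x => n; apply: Fx; exists n.
by have [x /H] := piece_nonempty (mkseq al n).
Qed.

Lemma ifs_index_mapP al x : ifs_index_map S K al = x <-> address al x.
Proof.
rewrite /ifs_index_map; set A := \bigcap_n _.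
have AP y : A y <-> address al y.
  (* The intersection starts at length 1 while [address] starts at length 0; the inclusion of each
     piece in its parent bridges the shift. *)
  split => [Ay n|aly n _]; last exact: aly.
  have := piece_take attK n (Ay n I); by rewrite take_mkseq.
have [y /AP Ay] := address_exists al.
have xA : A (xget 0 A) := xgetPex 0 (ex_intro _ y Ay).
split => [<-|alx]; first exact/AP.
by apply: address_unique alx; exact/AP.
Qed.

(** After the common prefix [c] the words continue with distinct letters [a] and [b], so the
    intersection lies in the image under [S_c] of the intersection of two first-level pieces. *)
Lemma incomparable_pieces s u v :
    (forall a b : 'I_m, a != b -> card_at_most s ((S a @` K) `&` (S b @` K))) ->
    ~~ prefix u v -> ~~ prefix v u ->
  card_at_most s (piece S K u `&` piece S K v).
Proof.
move=> FI uv vu; have [c [a [b [u' [v' [ab -> ->]]]]]] := incomparable_split uv vu.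
apply: card_at_most_sub (card_at_most_image (word_map S c) (FI a b ab)).
move=> _ [[x Kx <-] [y Ky]]; rewrite !word_map_cat /= => xy.
exists (S a (word_map S u' x)) => //; split.
  by exists (word_map S u' x) => //; apply: (word_map_attractor attK); exists x.
have -> : S a (word_map S u' x) = S b (word_map S v' y) by exact: word_map_inj (esym xy).
by exists (word_map S v' y) => //; apply: (word_map_attractor attK); exists y.
Qed.

(* The points [S_w p], [p] in the open set, are separated at scale [rho]: a nearby
   [S_v p] would lie in [S_w U] as well as in [S_v U]. *)
Lemma osc_neighbour_bound (q D : R) : 0 < q -> open_set_condition S ->
  exists N, forall (rho : R) (x : E) (s : seq (seq 'I_m)), 0 < rho -> uniq s ->
    {in s &, forall u v, u != v -> ~~ prefix u v} ->
    (forall w, w \in s -> q * rho <= word_ratio w /\ word_ratio w <= rho) ->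
    (forall w, w \in s -> exists2 y, piece S K w y & `|y - x| <= D * rho) ->
  (size s <= N)%N.
Proof.
move=> q0 [U [[p Up] oU tU SU]].
have /nbhs_ballP[e /= e0 pe] : nbhs p U by exact: open_nbhs_nbhs.
have [D' D'0 D'P] := piece_norm_bound p.
have c0 := euclid_const_gt0 (R := R) (d := d).
set c := euclid_const in c0.
have k0 : 0 < q * e / c by rewrite divr_gt0 // mulr_gt0.
have [N NP] := separated_seq_bound (d := d) (D' + D) k0.
have wordU w : word_map S w @` U `<=` U.
  elim: w => [|a w IH] _ [x Ux <-] //=.
  by apply: (SU a); exists (word_map S w x) => //; apply: IH; exists x.
exists N => rho x s rho0 us incs rats near_s.
(* Rescaling by [rho] about [x] removes the scale: the images lie in a ball of radius [D' + D] and
   are separated by [q * e / c], both independent of [rho]. *)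
pose f w := rho^-1 *: (word_map S w p - x).
have fB u v : f u - f v = rho^-1 *: (word_map S u p - word_map S v p).
  by rewrite /f -scalerBr opprB addrA subrK.
have sep : {in s &, forall u v, u != v -> q * e / c <= `|f u - f v|}.
  move=> u v us' vs uv; have uv' := incs _ _ us' vs uv.
  have vu' : ~~ prefix v u by apply: incs => //; rewrite eq_sym.
  rewrite fB normrZ gtr0_norm ?invr_gt0 // [leRHS]mulrC ler_pdivlMr //.
  rewrite leNgt; apply/negP => close.
  have [z zE] := word_map_surj r_gt0 S_sim u (word_map S v p).
  have Uz : U z.
    apply: pe; rewrite -ball_normE /ball_ /=.
    apply: le_lt_trans (norm_le_euclid_dist _ _) _.
    rewrite -(ltr_pM2l (word_ratio_gt0 r_gt0 u)) -(word_map_dist S_sim) zE.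
    apply: le_lt_trans (euclid_dist_le _ _) _; rewrite -/c mulrC -ltr_pdivlMr //.
    apply: lt_le_trans close _; rewrite mulrAC ler_pM2r ?invr_gt0 // mulrAC.
    by rewrite ler_pM2r //; exact: (rats _ us').1.
  (* Cancelling the common prefix leaves a point shared by [S_a U] and [S_b U] with [a] different
     from [b], against the open set condition. *)
  have [k [a [b [u' [v' [ab uE vE]]]]]] := incomparable_split uv' vu'.
  rewrite uE vE !word_map_cat /= in zE.
  have zE' : S a (word_map S u' z) = S b (word_map S v' p) by exact: word_map_inj zE.
  move/eqP: ab; apply; apply: (tU a b I I); exists (S a (word_map S u' z)); split.
    by exists (word_map S u' z) => //; apply: wordU; exists z.
  by exists (word_map S v' p) => //; apply: wordU; exists p.
have injf : {in s &, injective f}.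
  move=> u v us' vs fuv; apply/eqP; apply: contraT => uv.
  by have := sep _ _ us' vs uv; rewrite fuv subrr normr0 leNgt k0.
rewrite -(size_map f); apply: NP; first by rewrite map_inj_in_uniq.
  move=> _ /mapP[w ws ->]; rewrite normrZ gtr0_norm ?invr_gt0 // [leLHS]mulrC ler_pdivrMr //.
  have [y wy yx] := near_s _ ws.
  apply: le_trans (ler_distD y _ _) _; rewrite mulrDl; apply: lerD => //.
  apply: le_trans (D'P _ _ wy) _; rewrite mulrC ler_pM2l //; exact: (rats _ ws).2.
move=> _ _ /mapP[u us' ->] /mapP[v vs ->] fuv; apply: sep => //.
by apply: contraNneq fuv => ->.
Qed.

End PieceGeometry.

(** * Uniform finiteness bounds and the stars of a set *)

Section Stars.
Context {R : realType} {d m : nat}.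
Local Notation E := 'rV[R]_d.
Variables (S : 'I_m -> E -> E) (K : set E) (r : 'I_m -> R) (s : nat).
Hypotheses (r_gt0 : forall a, 0 < r a) (r_lt1 : forall a, r a < 1).
Hypothesis S_sim : forall a x y, euclid_dist (S a x) (S a y) = r a * euclid_dist x y.
Hypothesis attK : is_attractor S K.
Hypothesis conK : connected K.
Hypothesis finI : forall a b : 'I_m, a != b -> card_at_most s ((S a @` K) `&` (S b @` K)).
Hypothesis oscS : open_set_condition S.
Implicit Types (u v w : seq 'I_m) (al be : nat -> 'I_m) (x y : E) (A X : set E).
Local Notation word_ratio := (word_ratio r).
Local Notation cut_set := (cut_set r).
Local Notation address := (address S K).

(** Finitely many distinct addresses of [x] are cut at one small scale, which yields incomparable
    words of comparable ratio whose pieces all contain [x]; [osc_neighbour_bound] limits their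
    number. *)
Lemma addresses_card : exists N, forall x, card_at_most N [set al | address al x].
Proof.
have [q [q0 q1 qr _]] := ratio_bounds r_gt0 r_lt1.
have [N NP] := osc_neighbour_bound r_gt0 S_sim attK 0 q0 oscS.
exists N => x; apply: card_at_mostP => t ut tx.
have [|n0 n0P] := @eventually_forall_pairs _ [set` t]
    (fun al be n => al <> be -> mkseq al n <> mkseq be n) (finite_seq t).
  move=> al be _ _; have [->|/eqP/mkseq_neq[n0 n0P]] := eqVneq al be.
    by exists 0%N.
  by exists n0 => n n0n _; exact: n0P.
(* A word of length [k] has ratio at least [q ^+ k], so cutting at [q ^+ n0] happens at length [n0]
   or later, where the addresses already differ. *)
pose rho := q ^+ n0; have rho0 : 0 < rho by rewrite exprn_gt0.
have rho1 : rho <= 1 by rewrite exprn_ile1 // ltW.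
have /boolp.choice[k kP] : forall al, exists k, cut_set rho (mkseq al k).
  by move=> al; exact: cut_exists.
have n0k al : (n0 <= k al)%N.
  rewrite leqNgt; apply/negP => kn0; have [crho _] := kP al.
  have := le_trans (exp_le_word_ratio (mkseq al (k al)) q0 qr) crho.
  by rewrite size_mkseq leNgt /rho ltr_iXn2l ?kn0.
pose c al := mkseq al (k al).
have incs al be : al \in t -> be \in t -> al <> be -> ~~ prefix (c al) (c be).
  move=> alt bet albe; apply/negP => /prefix_mkseq.
  rewrite /c size_mkseq => /(mkseq_eq_le (n0k al)).
  exact: (n0P _ (leqnn _) _ _ alt bet albe).
have injc : {in t &, injective c}.
  move=> al be alt bet cc; apply: contrapT => albe.
  by have := incs _ _ alt bet albe; rewrite cc prefix_refl.
rewrite -(size_map c); apply: (NP rho x) => //; first by rewrite map_inj_in_uniq.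
- move=> _ _ /mapP[al alt ->] /mapP[be bet ->] cc; apply: incs => // albe.
  by rewrite albe eqxx in cc.
- move=> _ /mapP[al alt ->]; split; last by have [] := kP al.
  exact: (cut_ratio_ge rho0 rho1 q0 q1 qr (kP al)).
- move=> _ /mapP[al alt ->]; exists x; first exact: (tx _ alt).
  by rewrite subrr normr0 mul0r.
Qed.

(** Neighbours of the same length may be arbitrarily small compared with [K_w], so they are replaced
    by neighbours from the cut set at the ratio of [w]: at most [N] of them, each sharing at most
    [s] points with [K_w]. *)
Lemma piece_boundary_card : exists M, forall w, card_at_most M (piece_boundary S K w).
Proof.
have [q [q0 q1 qr _]] := ratio_bounds r_gt0 r_lt1.
have [D D0 DP] := piece_diameter r_gt0 S_sim attK.
have [N NP] := osc_neighbour_bound r_gt0 S_sim attK D q0 oscS.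
exists (N * s)%N => w; have w0 := word_ratio_gt0 r_gt0 w.
have w1 := word_ratio_le1 r_gt0 r_lt1 w.
have cw := cut_ratio r_gt0 r_lt1 w.
pose C := [set c | [/\ cut_set (word_ratio w) c, c != w & piece S K c `&` piece S K w !=set0]].
have cardC : card_at_most N C.
  have [x wx] := piece_nonempty attK w.
  apply: card_at_mostP => t ut tC; apply: (NP (word_ratio w) x) => //.
  - move=> u v ut' vt uv; apply: contra_neqN uv.
    by have [cu _ _] := tC _ ut'; have [cv _ _] := tC _ vt; exact: cut_prefix cu cv.
  - move=> c ct; have [cc _ _] := tC _ ct; split; last by have [] := cc.
    exact: (cut_ratio_ge w0 w1 q0 q1 qr cc).
  - move=> c ct; have [_ _ [y [cy wy]]] := tC _ ct.
    by exists y => //; rewrite mulrC; exact: DP wy wx.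
suff : piece_boundary S K w `<=` \bigcup_(c in C) (piece S K w `&` piece S K c).
  move=> /card_at_most_sub; apply; apply: card_at_most_bigcup cardC _ => c [cc cw' _].
  apply: (incomparable_pieces r_gt0 S_sim attK finI).
  - by apply: contra_neqN cw' => /(cut_prefix cw cc)/esym.
  - by apply: contra_neqN cw' => /(cut_prefix cc cw).
move=> p [j [/= jw jNw] [jp wp]].
(* An address of [p] through [j] is cut at the scale of [w]; if the cut word were [w] itself, then
   [j] would equal [w]. *)
have [al [alj alp]] := address_extension attK jp.
have [k ck] := cut_exists r_gt0 r_lt1 al w0.
exists (mkseq al k); last by split => //; exact: alp.
split => //; last by exists p; split => //; exact: alp.
apply: contraNneq jNw => kw; have kE : k = size w by rewrite -kw size_mkseq.
by rewrite -alj jw -kE kw.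
Qed.

Lemma finite_words n : finite_set [set w : seq 'I_m | size w = n].
Proof.
apply: (@sub_finite_set _ _ (range (@tval n 'I_m))); last exact/finite_image/finite_finset.
by move=> w /eqP wn; exists (Tuple wn).
Qed.

Definition words_meeting A n := [set w | size w = n /\ piece S K w `&` A !=set0].
Definition star A n := \bigcup_(w in words_meeting A n) piece S K w.
(** The rest of [K] at level [n], in the role of [W n] in [N_C_eventually]. *)
Definition costar A n :=
  \bigcup_(w in [set w | size w = n /\ piece S K w `&` A = set0]) piece S K w.

Lemma words_cover n x : K x -> exists2 w, size w = n & piece S K w x.
Proof.
rewrite -{1}(piece0 S K) => x0; have [w [wn _ wx]] := piece_words attK x0 (leq0n n).
by exists w.
Qed.

Lemma star_costar A n : K `<=` star A n `|` costar A n.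
Proof.
move=> x /(words_cover n)[w wn wx]; have [wA|wA] := eqVneq (piece S K w `&` A) set0.
  by right; exists w.
by left; exists w => //; split => //; exact/set0P.
Qed.

Lemma star_sub A n : star A n `<=` K.
Proof. by move=> x [w _]; exact: piece_sub. Qed.

Lemma sub_star A n : A `<=` K -> A `<=` star A n.
Proof.
move=> AK a Aa; have [w wn wa] := words_cover n (AK _ Aa).
by exists w => //; split => //; exists a.
Qed.

Lemma costar_disjoint A n : A `&` costar A n = set0.
Proof.
apply/seteqP; split => // a [Aa [w [_ wA] wa]].
by have : (piece S K w `&` A) a by []; rewrite wA.
Qed.

Lemma star_closed A n : closed (star A n).
Proof.
apply: closed_bigcup => [|w _]; last exact: piece_closed.
by apply: sub_finite_set (finite_words n) => w [].
Qed.

Lemma costar_closed A n : closed (costar A n).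
Proof.
apply: closed_bigcup => [|w _]; last exact: piece_closed.
by apply: sub_finite_set (finite_words n) => w [].
Qed.

Lemma star_compact A n : compact (star A n).
Proof. exact: subclosed_compact (@star_closed A n) (compactK attK) (@star_sub A n). Qed.

Lemma starS A n : star A n.+1 `<=` star A n.
Proof.
move=> x [w [wn [y [wy Ay]]] wx]; exists (take n w); last exact: piece_take wx.
by split; [rewrite size_take wn ltnSn | exists y; split => //; exact: piece_take wy].
Qed.

Lemma star_connected A n : A !=set0 -> A `<=` K -> connected A -> connected (star A n).
Proof.
move=> [a Aa] AK conA.
(* Adjoining [A] to each piece gives connected sets that all contain [a]. *)
have -> : star A n = \bigcup_(w in words_meeting A n) (A `|` piece S K w).
  apply/seteqP; split => x; first by move=> [w wA wx]; exists w => //; right.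
  by move=> [w wA [Ax|wx]]; [exact: sub_star | exists w].
apply: bigcup_connected; first by exists a => w _; left.
move=> w [_ [y [wy Ay]]]; apply: connectedU => //; first by exists y.
exact: piece_connected.
Qed.

Lemma star_nbhd A n : A !=set0 -> A `<=` K -> connected A -> continuum_nbhd K A (star A n).
Proof.
move=> A0 AK conA; split; [exact: star_sub | exact: star_compact | exact: star_connected | ].
apply/set_nbhsP; exists (~` costar A n); split.
- exact/closed_openC/costar_closed.
- by move=> a Aa ca; have : (A `&` costar A n) a by []; rewrite costar_disjoint.
- by move=> x nx /(star_costar A n)[].
Qed.

(** A point of all stars shares arbitrarily small pieces with points of the closed set [A], hence
    lies in [A]; compactness then gives one star inside [U]. *)
Lemma star_shrinks A (U : set E) : closed A -> A `<=` K -> open U -> A `<=` U ->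
  exists n, star A n `<=` U.
Proof.
move=> clA AK oU AU; pose F := range (star A).
have decS i j : (i <= j)%N -> star A j `<=` star A i.
  move=> /subnK <-; elim: (j - i)%N => // k IH.
  by rewrite addSn; exact: subset_trans (@starS A _) IH.
have F0 : F !=set0 by exists (star A 0); exists 0%N.
have Fcl D : F D -> compact D /\ closed D.
  by case=> n _ <-; split; [exact: star_compact | exact: star_closed].
have FI D1 D2 : F D1 -> F D2 -> F (D1 `&` D2).
  move=> [i _ <-] [j _ <-].
  wlog ij : i j / (i <= j)%N.
    by move=> H; have [/H//|/ltnW/H] := leqP i j; rewrite setIC.
  by rewrite setIidr; [exists j | exact: decS].
have [|D [n _ <-] H] := compact_directed_sub F0 Fcl FI oU; last by exists n.
move=> x Fx; apply: AU; apply: contrapT => nAx.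
have /nbhs_ballP[e /= e0 xe] : nbhs x (~` A).
  by apply: open_nbhs_nbhs; split => //; exact: closed_openC.
have [n nP] := piece_ball r_gt0 r_lt1 S_sim attK e0.
have [|w [wn [y [wy Ay]]] wx] := Fx (star A n); first by exists n.
by have := nP w; rewrite wn => /(_ (leqnn n) _ _ wx wy)/xe; apply.
Qed.

Lemma star_finely_connected A n : finely_connected (star A n).
Proof.
move=> e e0; have [k kP] := piece_ball r_gt0 r_lt1 S_sim attK e0.
(* Depth at least [k] makes the pieces small, and depth at least [n] lets them subdivide those of
   the star. *)
pose W := [set w | size w = maxn k n /\ piece S K w `<=` star A n].
exists (piece S K @` W); split.
- by apply: finite_image; apply: sub_finite_set (finite_words (maxn k n)) => w [].
- move=> _ [w [wk _] <-]; split; [exact: piece_closed | exact: piece_connected | ].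
  by apply: kP; rewrite wk leq_maxl.
- rewrite bigcup_image; apply/seteqP; split => x; last by move=> [w [_ wA]] /wA.
  move=> [w wA wx].
  have [|v [vk wv vx]] := piece_words attK wx (n := maxn k n).
    by case: wA => -> _; exact: leq_maxr.
  exists v => //; split => // y vy; exists w => //.
  exact: piece_prefix vy.
Qed.

(** The bound is available only from level [n0] on, so [N_C_eventually] is applied to the sequence
    shifted by [n0]. *)
Lemma N_C_star A M n0 : closed A -> connected A -> A !=set0 -> A `<=` K ->
    (forall n, (n0 <= n)%N -> card_at_most M (star A n `&` costar A n)) ->
  exists n1, forall n, (n1 <= n)%N -> num_components (star A n `\` A) = N_C K A.
Proof.
move=> clA conA A0 AK bnd.
have [|||||||n1 n1P] := @N_C_eventually R d K A (fun n => star A (n0 + n))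
    (fun n => costar A (n0 + n)) M (compactK attK) conK clA A0 AK.
- by move=> n; exact: star_nbhd.
- by move=> n; rewrite addnS; exact: starS.
- move=> U oU AU; have [n nU] := star_shrinks clA AK oU AU; exists n.
  elim: n0 {bnd} => // k IH; rewrite addSn.
  exact: subset_trans (@starS A _) IH.
- by move=> n; exact: star_finely_connected.
- by move=> n; exact: costar_closed.
- by move=> n; exact: star_costar.
- by move=> n; apply: bnd; exact: leq_addr.
exists (n0 + n1)%N => n n01; have n0n : (n0 <= n)%N by apply: leq_trans n01; exact: leq_addr.
by rewrite -(subnKC n0n) n1P // leq_subRL.
Qed.

End Stars.

(** * Words of a fixed length that meet a finite set *)

Section WordsMeeting.
Context {R : realType} {d m : nat}.
Local Notation E := 'rV[R]_d.
Variables (S : 'I_m -> E -> E) (K : set E) (r : 'I_m -> R) (s : nat).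
Hypotheses (r_gt0 : forall a, 0 < r a) (r_lt1 : forall a, r a < 1).
Hypothesis S_sim : forall a x y, euclid_dist (S a x) (S a y) = r a * euclid_dist x y.
Hypothesis attK : is_attractor S K.
Hypothesis finI : forall a b : 'I_m, a != b -> card_at_most s ((S a @` K) `&` (S b @` K)).
Hypothesis oscS : open_set_condition S.
Implicit Types (u v w : seq 'I_m) (al be : nat -> 'I_m) (x y : E) (A X : set E).
Local Notation address := (address S K).
Local Notation words_meeting := (words_meeting S K).
Local Notation "pi^-1" := (preimage (ifs_index_map S K)) (at level 0).

Let index_mapP := ifs_index_mapP r_gt0 r_lt1 S_sim attK.

Lemma address_index_map al : address al (ifs_index_map S K al).
Proof. exact/index_mapP. Qed.

(** Truncation of addresses provides the surjection required by [prec], and bounds the number of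
    words independently of [n] when [X] is finite. *)
Lemma words_meetingE X n : words_meeting X n = (fun al => mkseq al n) @` pi^-1 X.
Proof.
apply/seteqP; split => [w [wn [x [wx Xx]]]|_ [al Xal <-]].
  have [al [alw alx]] := address_extension attK wx.
  by exists al; rewrite -?wn //= (iffRL (index_mapP al x) alx).
split; first by rewrite size_mkseq.
exists (ifs_index_map S K al); split; last exact: Xal.
exact: address_index_map.
Qed.

Lemma words_meeting_prec X n : (0 < n)%N -> prec (words_meeting X n) (pi^-1 X).
Proof.
move=> n0; split.
- by move=> w [wn _]; rewrite /nonempty_words /= -size_eq0 wn -lt0n.
- move=> u v [un _] [vn _] uv; apply/andP; split; apply/negP => /prefix_size_eq.
    by rewrite un vn => /(_ erefl).
  by rewrite un vn => /(_ erefl)/esym.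
- exists (fun al => mkseq al n); split; first exact/esym/words_meetingE.
  by move=> al _; rewrite /initial_segment size_mkseq.
Qed.

Lemma preimage_index_map_card X : finite_set X -> exists M, card_at_most M (pi^-1 X).
Proof.
move=> fX; have [N NP] := addresses_card r_gt0 r_lt1 S_sim attK oscS.
have cX : card_at_most #|` fset_set X| X.
  by exists (fset_set X) => // x Xx; rewrite /= in_fset_set // inE.
exists (#|` fset_set X| * N)%N.
apply: card_at_most_sub (card_at_most_bigcup cX (fun x _ => NP x)) => al Xal.
by exists (ifs_index_map S K al) => //=; exact: address_index_map.
Qed.

Lemma deep_piece_meets_once X : finite_set X -> exists n0, forall n, (n0 <= n)%N ->
  forall w x y, size w = n -> X x -> X y -> piece S K w x -> piece S K w y -> x = y.
Proof.
move=> fX; have [|n0 n0P] := @eventually_forall_pairs _ X (fun x y n =>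
    forall w, size w = n -> piece S K w x -> piece S K w y -> x = y) fX.
  move=> x y _ _; have [->|/eqP xy] := eqVneq x y; first by exists 0%N.
  have [n0 n0P] := piece_separates r_gt0 r_lt1 S_sim attK xy.
  exists n0 => n n0n w wn wx wy; exfalso.
  by apply: n0P wx wy; rewrite wn.
by exists n0 => n n0n w x y wn Xx Xy; exact: n0P n0n _ _ Xx Xy _ wn.
Qed.

(** From the level where the addresses differ, their pieces share only points of a finite list; each
    of these other than the point of [al] eventually leaves the pieces along [al]. *)
Lemma address_pieces_separate al be : al <> be -> exists n0, forall n, (n0 <= n)%N ->
  forall x, piece S K (mkseq al n) x -> piece S K (mkseq be n) x ->
    x = ifs_index_map S K al.
Proof.
move=> /mkseq_neq[k kP].
have pieceS n i (ga : nat -> 'I_m) : (i <= n)%N ->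
    piece S K (mkseq ga n) `<=` piece S K (mkseq ga i).
  by move=> ni; rewrite -(take_mkseq ga ni); exact: piece_take.
have inc (u v : seq 'I_m) : size u = k -> size v = k -> u <> v -> ~~ prefix u v.
  by move=> uk vk uv; apply/negP => /prefix_size_eq; rewrite uk vk => /(_ erefl).
have kk := kP _ (leqnn k).
have : card_at_most s (piece S K (mkseq al k) `&` piece S K (mkseq be k)).
  apply: (incomparable_pieces r_gt0 S_sim attK finI); apply: inc; rewrite ?size_mkseq //.
  exact: nesym.
move=> [t _ tP].
have [|n0 n0P] := @eventually_forall_seq _ t (fun x n =>
    piece S K (mkseq al n) x -> x = ifs_index_map S K al).
  move=> x _; have [->|/eqP xal] := eqVneq x (ifs_index_map S K al); first by exists 0%N.
  have [n0 n0P] := piece_separates r_gt0 r_lt1 S_sim attK xal.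
  exists n0 => n n0n alx; exfalso; apply: (n0P (mkseq al n)) => //.
    by rewrite size_mkseq.
  exact: address_index_map.
exists (maxn k n0) => n; rewrite geq_max => /andP[kn n0n] x alx bex.
by apply: (n0P n) => //; apply: tP; split; exact: pieceS kn _ _.
Qed.

Lemma words_meeting_separate X : finite_set X -> exists n0, forall n, (n0 <= n)%N ->
  forall u v, words_meeting X n u -> words_meeting X n v -> u <> v ->
    piece S K u `&` piece S K v `<=` X.
Proof.
move=> fX; have [M /card_at_most_finite fP] := preimage_index_map_card fX.
have [|n0 n0P] := @eventually_forall_pairs _ (pi^-1 X) (fun al be n => al <> be ->
  forall x, piece S K (mkseq al n) x -> piece S K (mkseq be n) x ->
    x = ifs_index_map S K al) fP.
  move=> al be _ _; have [->|/eqP albe] := eqVneq al be; first by exists 0%N.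
  by have [n0 n0P] := address_pieces_separate albe; exists n0 => n n0n _; exact: n0P.
exists n0 => n n0n u v; rewrite words_meetingE => -[al Xal <-] [be Xbe <-] albe x [alx bex].
rewrite (n0P n n0n al be Xal Xbe _ x alx bex) // => eq_albe.
by apply: albe; rewrite eq_albe.
Qed.

(** A common point of star and costar is a boundary point of a piece that meets [X]. There are at
    most [M] such pieces, one per address over [X], each with at most [N] boundary points. *)
Lemma star_boundary_card A X : finite_set X ->
    (exists n0, forall n, (n0 <= n)%N -> forall u v, words_meeting A n u ->
       size v = n -> piece S K v `&` A = set0 -> piece S K u `&` piece S K v !=set0 ->
       words_meeting X n u) ->
  exists M n0, forall n, (n0 <= n)%N -> card_at_most M (star S K A n `&` costar S K A n).
Proof.
move=> fX [n0 n0P]; have [M cM] := preimage_index_map_card fX.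
have [N cN] := piece_boundary_card r_gt0 r_lt1 S_sim attK finI oscS.
exists (M * N)%N, n0 => n n0n.
have cX : card_at_most M (words_meeting X n).
  by rewrite words_meetingE; exact: card_at_most_image.
apply: card_at_most_sub (card_at_most_bigcup cX (fun w _ => cN w)).
move=> x [[u uA ux] [v [vn vA] vx]]; exists u.
  by apply: n0P vn vA _ => //; exists x.
exists v => //; split; first by rewrite vn; case: uA.
apply: contra_eqN vA => /eqP ->; apply/eqP => uA0.
by case: uA => _ [y]; rewrite uA0.
Qed.

End WordsMeeting.

(** * Construction of the two families *)

Lemma contracting_similarity_ratios (R : realType) (d m : nat)
    (S : 'I_m -> 'rV[R]_d -> 'rV[R]_d) :
  (forall a, contracting_similarity (S a)) -> exists r : 'I_m -> R,
  [/\ forall a, 0 < r a, forall a, r a < 1 &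
    forall a x y, euclid_dist (S a x) (S a y) = r a * euclid_dist x y].
Proof.
by move=> /boolp.choice[r rP]; exists r; split => a; have [] := rP a.
Qed.

Theorem proposition3p2 (R : realType) (d m s : nat)
    (S : 'I_m -> 'rV[R]_d -> 'rV[R]_d) (K : set 'rV[R]_d)
    (S_sim : forall a : 'I_m, contracting_similarity (S a))
    (S_FI : FI_system s S K)
    (S_OSC : open_set_condition S) :
  (forall x : 'rV[R]_d, K x ->
     exists J : set (seq 'I_m),
       [/\ prec J (ifs_index_map S K @^-1` [set x]),
           (forall j k : seq 'I_m, J j -> J k -> j <> k ->
              piece S K j `&` piece S K k = [set x]) &
           num_components (V_point S K J `\` [set x]) = N_C K [set x]])
  /\
  (forall i : seq 'I_m, nonempty_words i ->
     exists J : set (seq 'I_m),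
       [/\ prec J (ifs_index_map S K @^-1` piece_boundary S K i),
           (forall j : seq 'I_m, J j ->
              exists y : 'rV[R]_d,
                piece S K j `&` piece_boundary S K i = [set y]),
           trivIset J (fun j => piece S K j `\` piece S K i) &
           num_components (V_piece S K J i `\` piece S K i)
             = N_C K (piece S K i)]).
Proof.
have [r [r0 r1 rS]] := contracting_similarity_ratios S_sim.
have [attK conK FI] := S_FI.
have finI (a b : 'I_m) : a != b -> card_at_most s ((S a @` K) `&` (S b @` K)).
  by move=> ab; exact/card_at_most_II/FI.
split.
- move=> x Kx; have fx : finite_set [set x] by exact: finite_set1.
  have xK : [set x] `<=` K by move=> _ ->.
  have [|M [n1 n1P]] := star_boundary_card r0 r1 rS attK finI S_OSC fx (A := [set x]).
    by exists 0%N.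
  have [|||n2 n2P] := N_C_star r0 r1 rS attK conK _ _ _ xK n1P.
  + by apply: accessible_closed_set1; exact/hausdorff_accessible/norm_hausdorff.
  + exact: connected1.
  + by exists x.
  have [n3 n3P] := words_meeting_separate r0 r1 rS attK finI S_OSC fx.
  (* Level at least 1 excludes the empty word; [n2] fixes the count and [n3] the intersections. *)
  pose n := maxn 1 (maxn n2 n3).
  have [n_gt0 n2n n3n] : [/\ 0 < n, n2 <= n & n3 <= n]%N.
    by rewrite /n; split; lia.
  exists (words_meeting S K [set x] n); split.
  + exact: (words_meeting_prec r0 r1 rS).
  + move=> j k jx kx jk; apply/seteqP; split; first exact: n3P n3n _ _ jx kx jk.
    by case: jx kx => _ [y [jy <-]] [_ [z [kz zx]]] _ ->; split => //; rewrite -zx.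
  + exact: n2P.
move=> i _; set A := piece S K i; set X := piece_boundary S K i.
have [M0 /(_ i)/card_at_most_finite fX] := piece_boundary_card r0 r1 rS attK finI S_OSC.
have AK : A `<=` K by exact: piece_sub.
have XA : X `<=` A by move=> x [j _ []].
(* A word at least as long as [i] either extends [i], and its piece lies in [K_i], or has another
   initial segment of length [size i], and then the common point [x] is in the boundary. *)
have wordA n u x : (size i <= n)%N -> size u = n -> piece S K u x -> A x ->
    piece S K u `<=` A \/ X x.
  move=> i_n un ux Ax; have [ui|ui] := eqVneq (take (size i) u) i.
    by left; rewrite /A -ui; exact: piece_take.
  right; exists (take (size i) u); last by split => //; exact: piece_take ux.
  by split => //; rewrite size_takel // un.
have [|M [n1 n1P]] := star_boundary_card r0 r1 rS attK finI S_OSC fX (A := A).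
  exists (size i) => n i_n u v [un [y [uy Ay]]] vn vA [z [uz vz]].
  split => //; have [uA|Xy] := wordA n u y i_n un uy Ay; last by exists y.
  by have : (piece S K v `&` A) z by [split => //; exact: uA]; rewrite vA.
have [|||n2 n2P] := N_C_star r0 r1 rS attK conK _ _ _ AK n1P.
- exact: (piece_closed r0).
- exact: (piece_connected r0).
- exact: piece_nonempty.
have [n3 n3P] := words_meeting_separate r0 r1 rS attK finI S_OSC fX.
have [n4 n4P] := deep_piece_meets_once r0 r1 rS attK fX.
(* Beyond nonempty words of length at least [size i], the thresholds serve the count ([n2]),
   disjointness outside [K_i] ([n3]) and the single boundary point ([n4]). *)
pose n := maxn (maxn 1 (size i)) (maxn n2 (maxn n3 n4)).
have [n_gt0 i_n n2n [n3n n4n]] : [/\ 0 < n, size i <= n, n2 <= n & n3 <= n /\ n4 <= n]%N.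
  by rewrite /n; split; [lia|lia|lia|split; lia].
exists (words_meeting S K X n); split.
- exact: (words_meeting_prec r0 r1 rS).
- move=> j [jn [y [jy Xy]]]; exists y; apply/seteqP; split => [z [jz Xz]|_ -> //].
  exact: n4P n4n _ _ _ jn Xz Xy jz jy.
- move=> j k jX kX [z [[jz nAz] [kz _]]]; apply: contrapT => jk.
  by apply/nAz/XA/(n3P n n3n j k).
(* The star of [K_i] is [V_J(K_i)]: a piece of level [n] that meets [K_i] but not its boundary is
   contained in [K_i]. *)
- rewrite -(n2P n n2n); congr (num_components (_ `\` _)).
  apply/seteqP; split => [x [Ax|[j [jn [y [jy Xy]]] jx]]|x [j [jn [y [jy Ay]]] jx]].
  + exact: (sub_star attK).
  + by exists j => //; split => //; exists y; split => //; exact: XA.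
  + have [jA|Xy] := wordA n j y i_n jn jy Ay; first by left; exact: jA.
    by right; exists j => //; split => //; exists y.
Qed.
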